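(* Let $p$ be a prime and $r\in\mathbb Z$. Let $n_0\in\{0,\ldots,p-1\}$ and $n_1\in\{0,\ldots,p-2\}$. If $n_0\le n_1$, then $$B_{n_1-n_0}^{(p-n_0)}(-r)\equiv\frac1{(n_1)_{n_0}}\sum_{k=0}^{n_0}\binom{n_0}k(-1)^{n_0-k}(k-r)^{n_1}\pmod p.$$ If $n_0>n_1=0$, then $$B_{p-n_0+n_1-1}^{(p-n_0)}(-r)\equiv\frac{(-1)^{\{r\}_p-1}}{n_0!}\binom{n_0}{\{r\}_p}\pmod p.$$ If $n_0>n_1>0$, then $$B_{p-n_0+n_1-1}^{(p-n_0)}(-r)\equiv\frac{(-1)^{n_1}}{(n_0-n_1)!\,(n_1-1)!}\sum_{k=0}^{n_0}\binom{n_0}k(-1)^{k}(k-r)^{n_1}q_p(k-r)\pmod p.$$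
   Context: For $a\in\mathbb Z$ and a positive integer $m$, $\{a\}_m$ denotes the least nonnegative residue of $a$ modulo $m$. For a prime $p$ and $a\in\mathbb Z$, $q_p(a)=(a^{p-1}-1)/p$ (a rational number, which is an integer when $p\nmid a$). $(x)_0=1$ and $(x)_k=x(x-1)\cdots(x-k+1)$ for $k\ge1$. For $m\in\{0,1,2,\ldots\}$ the $m$-th order Bernoulli polynomials $B_n^{(m)}(t)$ ($n=0,1,2,\ldots$) are defined by $$\frac{x^me^{tx}}{(e^x-1)^m}=\sum_{n=0}^\infty B_n^{(m)}(t)\frac{x^n}{n!}.$$ Convention: $0^0=1$. Congruences modulo $p$ between rational numbers are understood in the ring $\mathbb Z_p$ of $p$-adic integers, i.e. $x\equiv y\pmod p$ means $x-y\in p\mathbb Z_p$. *)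

(* Defs.v *)
From HB Require Import structures.
From mathcomp Require Import all_boot all_order all_algebra.

Set Implicit Arguments.
Unset Strict Implicit.
Unset Printing Implicit Defensive.

Import Order.TTheory GRing.Theory Num.Theory.
Local Open Scope ring_scope.

(* A formal power series \sum_n a n x^n is encoded by its coefficients. *)
Definition series (R : Type) := nat -> R.

Definition ser_one (R : comUnitRingType) : series R := fun n => (n == 0%N)%:R.

Definition ser_mul (R : comUnitRingType) (a b : series R) : series R :=
  fun n => \sum_(i < n.+1) a i * b (n - i)%N.

Definition ser_exp (R : comUnitRingType) (a : series R) (m : nat) : series R :=
  iter m (ser_mul a) (ser_one R).

(* The first n coefficients of the inverse of a; meaningful when a 0 is a
   unit (see ser_mul_inv). *)
Fixpoint ser_inv_coefs (R : comUnitRingType) (a : series R) (n : nat) : seq R :=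
  if n is n'.+1 then
    let s := ser_inv_coefs a n' in
    rcons s ((a 0%N)^-1 *
             ((n' == 0%N)%:R - \sum_(i < n') a (n' - i)%N * s`_i))
  else [::].

Definition ser_inv (R : comUnitRingType) (a : series R) : series R :=
  fun n => (ser_inv_coefs a n.+1)`_n.

(* Below, the polynomial indeterminate 'X plays the role of t, and the power
   series in x have coefficients in {poly rat}. *)

(* (e^x - 1) / x *)
Definition ser_expm1_div : series {poly rat} :=
  fun n => ((n.+1)`!%:R^-1)%:P.

(* e^(t x) *)
Definition ser_exptx : series {poly rat} :=
  fun n => n`!%:R^-1 *: 'X^n.

(* The Bernoulli polynomial B_n^(m), read off from
   (x / (e^x - 1))^m e^(t x) = \sum_n B_n^(m)(t) x^n / n!;
   the equation without division is bernoulli_poly_gen. *)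
Definition bernoulli_poly (m n : nat) : {poly rat} :=
  n`!%:R *: ser_mul (ser_exp (ser_inv ser_expm1_div) m) ser_exptx n.

(* rat :&: Z_p: a rational lies in Z_p iff p does not divide its reduced
   denominator. *)
Definition p_integral (p : nat) (x : rat) : bool := ~~ (p %| `|denq x|)%N.

(* x - y \in p Z_p *)
Definition congr_Zp (p : nat) (x y : rat) : Prop :=
  exists2 z : rat, p_integral p z & x - y = p%:R * z.

Definition lres (a : int) (m : nat) : nat := `|(a %% m)%Z|%N.

(* A rational: it is not an integer when p divides a. *)
Definition fermat_quotient (p : nat) (a : int) : rat :=
  (a%:~R ^+ (p - 1) - 1) / p%:R.

Section SeriesTheory.
Variable R : comUnitRingType.
Implicit Types a b c : series R.

Lemma eq_ser_mul a a' b b' : a =1 a' -> b =1 b' -> ser_mul a b =1 ser_mul a' b'.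
Proof. by move=> ea eb n; apply: eq_bigr => i _; rewrite ea eb. Qed.

Let tr N a : {poly R} := \poly_(i < N) a i.

Let coef_tr_mul N a b n : (n < N)%N -> (tr N a * tr N b)`_n = ser_mul a b n.
Proof.
move=> nN; rewrite coefM; apply: eq_bigr => i _; rewrite !coef_poly.
have iN : (i < N)%N by apply: leq_trans nN; exact: ltn_ord.
by rewrite iN (leq_ltn_trans (leq_subr _ _) nN).
Qed.

Lemma ser_mulC a b : ser_mul a b =1 ser_mul b a.
Proof. by move=> n; rewrite -!(@coef_tr_mul n.+1) // mulrC. Qed.

Lemma ser_mulA a b c : ser_mul a (ser_mul b c) =1 ser_mul (ser_mul a b) c.
Proof.
move=> n; have ltS (i : 'I_n.+1) : (n - i < n.+1)%N by rewrite ltnS leq_subr.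
transitivity ((tr n.+1 a * (tr n.+1 b * tr n.+1 c))`_n).
  rewrite coefM; apply: eq_bigr => i _.
  by rewrite (coef_tr_mul _ _ (ltS i)) coef_poly ltn_ord.
rewrite mulrA coefM; apply: eq_bigr => i _.
by rewrite (coef_tr_mul _ _ (ltn_ord i)) coef_poly ltS.
Qed.

Lemma ser_mul1 a : ser_mul (ser_one R) a =1 a.
Proof.
move=> n; rewrite /ser_mul big_ord_recl /ser_one eqxx mul1r subn0.
by rewrite big1 ?addr0 // => i _; rewrite mul0r.
Qed.

Lemma ser_expMn a b m :
  ser_exp (ser_mul a b) m =1 ser_mul (ser_exp a m) (ser_exp b m).
Proof.
elim: m => [|m IHm] n; first by rewrite /= ser_mul1.
rewrite /= (eq_ser_mul (frefl _) IHm) -/(ser_exp a m) -/(ser_exp b m).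
rewrite -2!ser_mulA; apply: eq_ser_mul => // k.
rewrite !ser_mulA; apply: eq_ser_mul => // j; exact: ser_mulC.
Qed.

Lemma eq_ser_exp a b m : a =1 b -> ser_exp a m =1 ser_exp b m.
Proof. by move=> eab; elim: m => //= m IHm; apply: eq_ser_mul. Qed.

Lemma ser_exp1 m : ser_exp (ser_one R) m =1 ser_one R.
Proof. by elim: m => //= m IHm n; rewrite ser_mul1. Qed.

Lemma size_ser_inv_coefs a n : size (ser_inv_coefs a n) = n.
Proof. by elim: n => //= n IHn; rewrite size_rcons IHn. Qed.

Lemma nth_ser_inv_coefs a n i :
  (i < n)%N -> (ser_inv_coefs a n)`_i = ser_inv a i.
Proof.
elim: n => // n IHn; rewrite ltnS leq_eqVlt => /orP[/eqP-> // | lt_in].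
by rewrite /= nth_rcons size_ser_inv_coefs lt_in IHn.
Qed.

Lemma ser_mul_inv a :
  a 0%N \is a GRing.unit -> ser_mul a (ser_inv a) =1 ser_one R.
Proof.
move=> ua n; rewrite ser_mulC /ser_mul big_ord_recr /= subnn.
rewrite {2}/ser_inv /= nth_rcons size_ser_inv_coefs ltnn eqxx.
rewrite mulrC mulrA mulrV // mul1r addrC.
rewrite [X in _ - X + _](_ : _ = \sum_(i < n) ser_inv a i * a (n - i)%N).
  by rewrite subrK.
by apply: eq_bigr => i _; rewrite nth_ser_inv_coefs // mulrC.
Qed.

End SeriesTheory.

(* x *)
Definition ser_x : series {poly rat} := fun n => (n == 1%N)%:R.

(* e^x - 1 *)
Definition ser_expm1 : series {poly rat} :=
  fun n => if n == 0%N then 0 else (n`!%:R^-1)%:P.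

Lemma ser_expm1E : ser_expm1 =1 ser_mul ser_x ser_expm1_div.
Proof.
case=> [|n]; rewrite /ser_mul /ser_x.
  by rewrite big_ord_recl big_ord0 mul0r addr0.
rewrite 2!big_ord_recl /= mul0r add0r mul1r big1 ?addr0 => [|i _].
  by rewrite /ser_expm1 /= /ser_expm1_div subSS subn0.
by rewrite mul0r.
Qed.

(* (e^x - 1)^m * \sum_n B_n^(m)(t) x^n / n! = x^m e^(t x) *)
Lemma bernoulli_poly_gen (m : nat) :
  ser_mul (ser_exp ser_expm1 m) (fun n => n`!%:R^-1 *: bernoulli_poly m n)
    =1 ser_mul (ser_exp ser_x m) ser_exptx.
Proof.
have eB : (fun n => n`!%:R^-1 *: bernoulli_poly m n)
    =1 ser_mul (ser_exp (ser_inv ser_expm1_div) m) ser_exptx.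
  move=> n; rewrite /bernoulli_poly scalerA mulVf ?scale1r //.
  by rewrite pnatr_eq0 -lt0n fact_gt0.
move=> n; rewrite (eq_ser_mul (frefl _) eB) (eq_ser_mul (eq_ser_exp m ser_expm1E) (frefl _)).
rewrite (eq_ser_mul (@ser_expMn _ _ _ m) (frefl _)) -ser_mulA.
apply: eq_ser_mul => // {}n.
rewrite ser_mulA -[RHS]ser_mul1; apply: eq_ser_mul => // {}n.
rewrite -ser_expMn -[RHS](ser_exp1 _ m); apply: eq_ser_exp.
by apply: ser_mul_inv; rewrite /ser_expm1_div invr1 polyC1 unitr1.
Qed.

(* Main.v *)
(* Put G = (e^x - 1)/x, whose coefficients below x^(p-1) are p-integral.  Then
   B_N^(p-n0)(t) / N! is the coefficient of x^N in G^(-p) * (G^n0 e^(tx)), and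
   by Frobenius G^(-p) = 1 modulo p and x^(p-1).  Hence, for N <= p - 2,
     B_N^(p-n0)(t) = N! / (N + n0)! * Delta^n0 (t^(N + n0))   (mod p),
   where Delta is the forward difference in t.  For n0 <= n1 this is the claim
   with N = n1 - n0.  For n0 > n1 the exponent N + n0 is p - 1 + n1, and one
   applies Fermat to the powers, using that Delta^n0 kills t^n1. *)

From HB Require Import structures.
Require Import Defs.
From mathcomp Require Import all_boot all_order all_algebra.
From mathcomp Require Import ring zify.

Set Implicit Arguments.
Unset Strict Implicit.
Unset Printing Implicit Defensive.

Import Order.TTheory GRing.Theory Num.Theory.
Local Open Scope ring_scope.

(** * Power series modulo a power of x, as polynomials *)

Section TruncatedSeries.
Variable R : comNzRingType.
Implicit Types A B : {poly R}.

(** This is congruence modulo x^M. Truncating series to polynomials makes the ring laws, the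
    binomial theorem and [ring] available. *)
Definition eq_upto M A B := forall n, (n < M)%N -> A`_n = B`_n.

Lemma eq_upto_trans M B A C : eq_upto M A B -> eq_upto M B C -> eq_upto M A C.
Proof. by move=> AB BC n nM; rewrite AB ?BC. Qed.

Lemma eq_upto_mul M A A' B B' :
  eq_upto M A A' -> eq_upto M B B' -> eq_upto M (A * B) (A' * B').
Proof.
move=> eA eB n nM; rewrite !coefM; apply: eq_bigr => i _.
have iM : (i < M)%N by apply: leq_trans nM; exact: ltn_ord.
by rewrite eA // eB // (leq_ltn_trans (leq_subr _ _)).
Qed.

Lemma eq_upto_exp M A A' k : eq_upto M A A' -> eq_upto M (A ^+ k) (A' ^+ k).
Proof. by move=> eA; elim: k => // k IHk; rewrite !exprS; apply: eq_upto_mul. Qed.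

Lemma eq_upto_poly M L (a : nat -> R) :
  (M <= L)%N -> eq_upto M (\poly_(i < M) a i) (\poly_(i < L) a i).
Proof. by move=> ML n nM; rewrite !coef_poly nM (leq_trans nM ML). Qed.

End TruncatedSeries.
Arguments eq_upto_trans {R M} B {A C}.

(** * Truncated exponentials and finite differences of powers *)

Definition expx_trunc (L : nat) (t : rat) : {poly rat} :=
  \poly_(i < L) (t ^+ i / i`!%:R).

Definition expm1_div_trunc (L : nat) : {poly rat} :=
  \poly_(i < L) (i.+1`!%:R)^-1.

Lemma fact_rat_neq0 n : n`!%:R != 0 :> rat.
Proof. by rewrite pnatr_eq0 -lt0n fact_gt0. Qed.

(** Coefficientwise this is the binomial theorem for (s + t)^n divided by n!. *)
Lemma expx_truncD L s t :
  eq_upto L (expx_trunc L s * expx_trunc L t) (expx_trunc L (s + t)).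
Proof.
move=> n nL; rewrite coefM coef_poly nL addrC exprDn mulr_suml.
apply: eq_bigr => i _; have le_in : (i <= n)%N by rewrite -ltnS.
have iL : (i < L)%N by apply: leq_ltn_trans nL.
rewrite !coef_poly iL (leq_ltn_trans (leq_subr _ _) nL).
have := bin_fact le_in => /(congr1 (fun m : nat => m%:R : rat)).
rewrite !natrM => eqb; rewrite -eqb -mulr_natr.
have := fact_rat_neq0 i; have := fact_rat_neq0 (n - i).
have : 'C(n, i)%:R != 0 :> rat by rewrite pnatr_eq0 -lt0n bin_gt0.
by move=> ? ? ?; field; do ?[apply/andP; split].
Qed.

Lemma expx_trunc0 L : eq_upto L (expx_trunc L 0) 1.
Proof.
move=> n nL; rewrite coef_poly nL coef1 expr0n.
by case: n {nL} => [|n]; rewrite ?mul0r // fact0 divr1.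
Qed.

Lemma expx_truncX L t i :
  eq_upto L (expx_trunc L t ^+ i) (expx_trunc L (i%:R * t)).
Proof.
elim: i => [|i IHi]; first by move=> n nL; rewrite expr0 mul0r expx_trunc0.
rewrite exprS; apply: (eq_upto_trans (expx_trunc L t * expx_trunc L (i%:R * t))).
  exact: eq_upto_mul.
by rewrite -natr1 mulrDl mul1r addrC; apply: expx_truncD.
Qed.

Lemma expm1_trunc L :
  eq_upto L ('X * expm1_div_trunc L) (expx_trunc L 1 - 1).
Proof.
move=> n nL; rewrite coefXM coefB !coef_poly nL expr1n mul1r coef1.
case: n nL => [|n] nL /=; first by rewrite fact0 invr1 subrr.
by rewrite (ltnW nL) subr0.
Qed.

(** The k-th forward difference of the function t^m, in explicit form; for t = -r it is the sum in
    the first congruence of the theorem. *)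
Definition pow_diff (k m : nat) (t : rat) : rat :=
  \sum_(i < k.+1) 'C(k, i)%:R * (-1) ^+ (k - i) * (i%:R + t) ^+ m.

(** Expand (e^x - 1)^k by the binomial theorem: each term e^(ix) e^(tx) equals e^((i + t)x), whose
    coefficient of x^m is (i + t)^m / m!. *)
Lemma coef_expm1_pow L k m t : (m < L)%N ->
  (('X * expm1_div_trunc L) ^+ k * expx_trunc L t)`_m
    = pow_diff k m t / m`!%:R.
Proof.
move=> mL; rewrite (eq_upto_mul (eq_upto_exp k (@expm1_trunc L)) (fun _ _ => erefl _)) //.
rewrite addrC exprDn mulr_suml coef_sum mulr_suml.
apply: eq_bigr => i _.
have sgnC : (-1) ^+ (k - i) = ((-1) ^+ (k - i))%:P :> {poly rat}.
  by rewrite rmorphXn rmorphN.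
rewrite [in LHS]mulrnAl coefMn -[in LHS]mulrA sgnC coefCM.
have -> : (expx_trunc L 1 ^+ i * expx_trunc L t)`_m = (i%:R + t) ^+ m / m`!%:R.
  have eL : eq_upto L (expx_trunc L 1 ^+ i * expx_trunc L t)
      (expx_trunc L (i%:R * 1) * expx_trunc L t).
    by apply: eq_upto_mul => //; apply: expx_truncX.
  by rewrite eL // expx_truncD // mulr1 coef_poly mL.
by rewrite -[LHS]mulr_natl !mulrA.
Qed.

(** The series (e^x - 1)^k is divisible by x^k, so its product with e^(tx) has no term of degree m <
    k. *)
Lemma pow_diff_eq0 k m t : (m < k)%N -> pow_diff k m t = 0.
Proof.
move=> mk; have := @coef_expm1_pow m.+1 k m t (ltnSn m).
rewrite exprMn -mulrA coefXnM mk => /esym/eqP.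
by rewrite mulf_eq0 invr_eq0 (negPf (fact_rat_neq0 _)) orbF => /eqP.
Qed.

(** Dividing (e^x - 1)^k by x^k moves the coefficient of x^(N + k) to x^N. *)
Lemma coef_expm1_div_pow N k t :
  (expm1_div_trunc N.+1 ^+ k * expx_trunc N.+1 t)`_N
    = pow_diff k (N + k) t / (N + k)`!%:R.
Proof.
rewrite -(@coef_expm1_pow (N + k).+1) // exprMn -mulrA coefXnM.
rewrite ltnNge leq_addl /= addnK.
(* The two sides are truncated at different lengths, but agree in all degrees up to N. *)
have le : (N.+1 <= (N + k).+1)%N by rewrite ltnS leq_addr.
by apply: (@eq_upto_mul _ N.+1) => //; [apply: eq_upto_exp|]; apply: eq_upto_poly.
Qed.

(** * Values of the Bernoulli polynomials as coefficients over the rationals *)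

Section Bernoulli.
Variable t : rat.

Definition expm1_div_inv_trunc (L : nat) : {poly rat} :=
  \poly_(i < L) (ser_inv ser_expm1_div i).[t].

(** Evaluation at t is a ring morphism from [{poly rat}] to [rat]; A is the truncated image of the
    series a under it. Hence products, one and powers carry over. *)
Let repr L (A : {poly rat}) (a : series {poly rat}) :=
  forall n, (n < L)%N -> A`_n = (a n).[t].

Let repr_mul L A B a b : repr L A a -> repr L B b -> repr L (A * B) (ser_mul a b).
Proof.
move=> eA eB n nL; rewrite coefM horner_sum; apply: eq_bigr => i _.
have iL : (i < L)%N by apply: leq_trans nL; exact: ltn_ord.
by rewrite hornerM eA // eB // (leq_ltn_trans (leq_subr _ _)).
Qed.

Let repr_one L : repr L 1 (ser_one _).
Proof. by move=> n _; rewrite coef1 /ser_one; case: eqP; rewrite hornerE. Qed.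

Let repr_exp L A a k : repr L A a -> repr L (A ^+ k) (ser_exp a k).
Proof.
by move=> eA; elim: k => [|k IHk]; [exact: repr_one|rewrite exprS; exact: repr_mul].
Qed.

Let repr_inv L : repr L (expm1_div_inv_trunc L) (ser_inv ser_expm1_div).
Proof. by move=> n nL; rewrite coef_poly nL. Qed.

Lemma expm1_div_truncV L :
  eq_upto L (expm1_div_trunc L * expm1_div_inv_trunc L) 1.
Proof.
move=> n nL; rewrite (@repr_mul L _ _ ser_expm1_div (ser_inv ser_expm1_div)) //.
  rewrite ser_mul_inv ?(@repr_one L) //.
  by rewrite /ser_expm1_div invr1 polyC1 unitr1.
by move=> m mL; rewrite coef_poly mL hornerC.
Qed.

Lemma bernoulli_poly_horner m N :
  (bernoulli_poly m N).[t]
    = N`!%:R * (expm1_div_inv_trunc N.+1 ^+ m * expx_trunc N.+1 t)`_N.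
Proof.
rewrite /bernoulli_poly hornerZ; congr (_ * _).
rewrite (@repr_mul N.+1 _ _ (ser_exp (ser_inv ser_expm1_div) m) ser_exptx) //.
  exact: repr_exp.
by move=> n nN; rewrite coef_poly nN /ser_exptx hornerZ hornerXn mulrC.
Qed.

End Bernoulli.

(** * The ring of p-integral rationals *)

Section PIntegral.
Variables (p : nat) (hp : prime p).

Let p_rat_neq0 : p%:R != 0 :> rat.
Proof. by rewrite pnatr_eq0 -lt0n prime_gt0. Qed.

(** Allowing any denominator prime to p, reduced or not, makes closure under sums and products
    immediate: denominators multiply. *)
Lemma p_integralP (x : rat) :
  reflect (exists d a : int, ~~ (p %| d)%Z /\ d%:~R * x = a%:~R) (p_integral p x).
Proof.
apply: (iffP idP) => [pd|[d [a [pNd ax]]]].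
  by exists (denq x), (numq x); rewrite dvdzE /= numqE mulrC.
apply: contra pNd; rewrite dvdzE /= => /dvdn_trans; apply.
(* The reduced denominator divides [d * numq x] and is coprime to [numq x], so it divides d. *)
have : d * numq x = a * denq x.
  by apply: (intr_inj (R := rat)); rewrite !intrM numqE mulrA ax.
move=> /(congr1 (fun z : int => `|z|%N)); rewrite !abszM => e.
rewrite -(@Gauss_dvdl _ _ `|numq x|%N) ?e ?dvdn_mull //.
by rewrite coprime_sym coprime_num_den.
Qed.

Fact p_integral_subring : subring_closed (p_integral p).
Proof.
split=> [|x y /p_integralP[d [a [pd ax]]] /p_integralP[e [b [pe bx]]]|
          x y /p_integralP[d [a [pd ax]]] /p_integralP[e [b [pe bx]]]].
- by rewrite /p_integral -topredE /= /p_integral dvdn1 neq_ltn prime_gt1 ?orbT.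
- apply/p_integralP; exists (d * e), (e * a - d * b); split.
    by rewrite dvdzE abszM Euclid_dvdM // negb_or; apply/andP.
  by rewrite rmorphB !rmorphM /= -ax -bx; ring.
- apply/p_integralP; exists (d * e), (a * b); split.
    by rewrite dvdzE abszM Euclid_dvdM // negb_or; apply/andP.
  by rewrite !rmorphM /= -ax -bx; ring.
Qed.

(* The prime hypothesis is an argument so that the closure properties can be
   inferred from the name of the predicate. *)
Definition Zp_loc of prime p : {pred rat} := p_integral p.

HB.instance Definition _ := GRing.isSubringClosed.Build rat (Zp_loc hp)
  p_integral_subring.

Local Notation Zp := (Zp_loc hp).

Lemma Zp_int (a : int) : a%:~R \in Zp. Proof. exact: rpred_int. Qed.

Lemma Zp_invz (a : int) : ~~ (p %| a)%Z -> a%:~R^-1 \in Zp.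
Proof.
move=> pa; apply/p_integralP; exists a, 1; split=> //.
by rewrite mulfV // intr_eq0; apply: contra pa => /eqP->; rewrite dvdz0.
Qed.

Lemma Zp_invn (n : nat) : ~~ (p %| n)%N -> n%:R^-1 \in Zp.
Proof. by move=> pn; apply: (@Zp_invz n%:Z). Qed.

Lemma ndvdn_small (n : nat) : (0 < n < p)%N -> ~~ (p %| n)%N.
Proof. by case/andP=> n0 np; apply/negP => /(dvdn_leq n0); rewrite leqNgt np. Qed.

Lemma ndvdn_fact (n : nat) : (n < p)%N -> ~~ (p %| n`!)%N.
Proof.
elim: n => [|n IHn] np; first by rewrite fact0 dvdn1 neq_ltn prime_gt1 ?orbT.
by rewrite factS Euclid_dvdM // negb_or IHn ?(ltnW np) // ndvdn_small.
Qed.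

Lemma Zp_fact_inv (n : nat) : (n < p)%N -> n`!%:R^-1 \in Zp.
Proof. by move=> np; apply/Zp_invn/ndvdn_fact. Qed.

(** * Calculus of congruences modulo p *)

Lemma congr_Zp_refl x : congr_Zp p x x.
Proof. by exists 0; [exact: (rpred0 Zp)|rewrite subrr mulr0]. Qed.

Lemma congr_Zp_trans y x z : congr_Zp p x y -> congr_Zp p y z -> congr_Zp p x z.
Proof.
move=> [u uZ eu] [v vZ ev]; exists (u + v); first exact: (rpredD (S := Zp)).
by rewrite mulrDr -eu -ev; ring.
Qed.

Lemma congr_Zp_opp x y : congr_Zp p x y -> congr_Zp p (- x) (- y).
Proof.
move=> [u uZ eu]; exists (- u); first by rewrite -[_ (- u)]/(- u \in Zp) rpredN.
by rewrite mulrN -eu; ring.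
Qed.

Lemma congr_Zp_add x x' y y' :
  congr_Zp p x x' -> congr_Zp p y y' -> congr_Zp p (x + y) (x' + y').
Proof.
move=> [u uZ eu] [v vZ ev]; exists (u + v); first exact: (rpredD (S := Zp)).
by rewrite mulrDr -eu -ev; ring.
Qed.

Lemma congr_Zp_sum I (s : seq I) (P : pred I) (F G : I -> rat) :
    (forall i, P i -> congr_Zp p (F i) (G i)) ->
  congr_Zp p (\sum_(i <- s | P i) F i) (\sum_(i <- s | P i) G i).
Proof.
move=> FG; elim/big_rec2: _ => [|i x y Pi xy]; first exact: congr_Zp_refl.
by apply: congr_Zp_add => //; apply: FG.
Qed.

(** From x y - x' y' = x (y - y') + (x - x') y', where only the factors x and y' have to be
    integral. *)
Lemma congr_Zp_mul x x' y y' : x \in Zp -> y' \in Zp ->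
  congr_Zp p x x' -> congr_Zp p y y' -> congr_Zp p (x * y) (x' * y').
Proof.
move=> xZ yZ [u uZ eu] [v vZ ev]; exists (x * v + u * y').
  by apply: (rpredD (S := Zp)); apply: (rpredM (s := Zp)).
by rewrite mulrDr [p%:R * (_ * v)]mulrCA -ev mulrA -eu; ring.
Qed.

Lemma congr_Zp_mull x y z : x \in Zp -> congr_Zp p y z -> congr_Zp p (x * y) (x * z).
Proof.
move=> xZ [v vZ ev]; exists (x * v); first exact: (rpredM (s := Zp)).
by rewrite mulrCA -ev; ring.
Qed.

Lemma congr_Zp_mulr x y z : x \in Zp -> congr_Zp p y z -> congr_Zp p (y * x) (z * x).
Proof. by rewrite ![_ * x]mulrC; apply: congr_Zp_mull. Qed.

Lemma congr_Zp_int (a b : int) : (a = b %[mod p])%Z -> congr_Zp p a%:~R b%:~R.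
Proof.
move/eqP; rewrite eqz_mod_dvd => /dvdzP[q e]; exists q%:~R; first exact: Zp_int.
by rewrite -rmorphB e rmorphM mulrC.
Qed.

(** Here 1/a - 1/b = (b - a)/(a b), and a is prime to p because b is. *)
Lemma congr_Zp_inv (a b : int) : (a = b %[mod p])%Z -> ~~ (p %| b)%Z ->
  congr_Zp p a%:~R^-1 b%:~R^-1.
Proof.
move=> eab pb; have pa : ~~ (p %| a)%Z.
  by apply: contra pb => /dvdz_mod0P pa; apply/dvdz_mod0P; rewrite -eab.
have neq0 (c : int) : ~~ (p %| c)%Z -> c%:~R != 0 :> rat.
  by apply: contra; rewrite intr_eq0 => /eqP->; rewrite dvdz0.
have [z zZ ez] := congr_Zp_int (esym eab).
exists (z * (a%:~R^-1 * b%:~R^-1)).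
  by apply: (rpredM (s := Zp)) => //; apply: (rpredM (s := Zp)); apply: Zp_invz.
rewrite mulrA -ez; field.
by rewrite !neq0.
Qed.

(** * Fermat's little theorem over the integers *)

Lemma lresE (a : int) : (lres a p)%:Z = (a %% p)%Z.
Proof. by rewrite /lres gez0_abs // modz_ge0 // -lt0n prime_gt0. Qed.

(** The claim depends only on a modulo p, so a may be replaced by its least residue, a natural
    number. *)
Lemma fermat_int (a : int) : (p %| a ^+ p - a)%Z.
Proof.
rewrite -eqz_mod_dvd -modzXm -[X in _ == X]modz_mod -(lresE a).
by rewrite -[X in X ^+ _]natz -natrX natz !modz_nat fermat_little.
Qed.

Lemma fermat_int_coprime (a : int) : ~~ (p %| a)%Z -> (p %| a ^+ (p - 1) - 1)%Z.
Proof.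
move=> pa; have := fermat_int a; rewrite -{1}(subnK (prime_gt0 hp)) addn1 exprS.
have -> : a * a ^+ (p - 1) - a = a * (a ^+ (p - 1) - 1) by ring.
by rewrite Gauss_dvdzr // coprimezE prime_coprime.
Qed.

(** * Reduction of the Bernoulli values to finite differences modulo p *)

(** With constant term 1, the recurrence for the coefficients of the inverse involves no
    division. *)
Lemma polyOver_series_inv L (G H : {poly rat}) :
    G \is a polyOver Zp -> G`_0 = 1 -> eq_upto L (G * H) 1 -> (size H <= L)%N ->
  H \is a polyOver Zp.
Proof.
move=> /polyOverP GZ G0 GH sH; apply/polyOverP => n.
have [n_lt|] := ltnP n L; last by move/(leq_trans sH)/leq_sizeP => ->; rewrite ?rpred0.
elim/ltn_ind: n n_lt => n IHn nL.
have := GH n nL; rewrite coefM big_ord_recl /= G0 mul1r subn0 => /(canRL (addrK _)) ->.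
rewrite rpredB ?coef1 ?rpred_nat // rpred_sum // => i _; rewrite rpredM //.
by apply: IHn; rewrite /bump /=; [have := ltn_ord i|]; lia.
Qed.

(** Write A = xZ + 1 and expand A^p: the inner binomial coefficients are divisible by p, and (xZ)^p
    has no term of degree n < p. *)
Lemma congr_Zp_frobenius (A : {poly rat}) n :
    A \is a polyOver Zp -> A`_0 = 1 -> (n < p)%N ->
  congr_Zp p (A ^+ p)`_n (1 : {poly rat})`_n.
Proof.
move=> AZ A0 np; pose Z := drop_poly 1 A.
have ZZ : Z \is a polyOver Zp.
  by apply/polyOverP => i; rewrite coef_drop_poly (polyOverP AZ).
have -> : A = 'X * Z + 1.
  apply/polyP=> -[|i]; rewrite coefD coefXM coef1 ?A0 ?add0r //=.
  by rewrite addr0 coef_drop_poly addn1.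
rewrite exprDn coef_sum big_ord_recr /= subnn binn expr1n !mul1r mulr1n addrC.
rewrite -[X in congr_Zp _ _ X]addr0; apply: congr_Zp_add; first exact: congr_Zp_refl.
have sum0 : \sum_(i < p) 0 = 0 :> rat by rewrite big1.
rewrite -[X in congr_Zp _ _ X]sum0.
apply: congr_Zp_sum => i _; rewrite expr1n mulr1; have ip := ltn_ord i.
(* The index i is the exponent of 1, so i = 0 gives the term (xZ)^p; i = p was split off above. *)
have [->|i_neq0] := eqVneq (i : nat) 0%N.
  by rewrite bin0 mulr1n subn0 exprMn coefXnM np; apply: congr_Zp_refl.
have /dvdnP[c ec] : (p %| 'C(p, i))%N by apply: prime_dvd_bin => //; lia.
exists (('X * Z) ^+ (p - i) *+ c)`_n; last first.
  by rewrite subr0 ec mulrnA coefMn mulr_natl.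
suff: ('X * Z) ^+ (p - i) *+ c \is a polyOver Zp by move/polyOverP; apply.
by rewrite rpredMn // rpredX // rpredM // polyOverX.
Qed.

(** The bound on N keeps the denominators (i + 1)! of G, for i <= N, prime to p. The right-hand side
    is N! times a coefficient of G^n0 e^(tx), hence p-integral even if p divides (N + n0)!. *)
Lemma congr_bernoulli n0 N (a : int) : (n0 <= p)%N -> (N.+1 < p)%N ->
  congr_Zp p (bernoulli_poly (p - n0) N).[a%:~R]
    (N`!%:R * (pow_diff n0 (N + n0) a%:~R / (N + n0)`!%:R)).
Proof.
move=> n0p Np; rewrite bernoulli_poly_horner -coef_expm1_div_pow.
set G := expm1_div_trunc _; set H := expm1_div_inv_trunc _ _; set E := expx_trunc _ _.
have GZ : G \is a polyOver Zp.
  apply/polyOverP => i; rewrite coef_poly; case: ltnP; rewrite ?rpred0 // => iN.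
  by rewrite Zp_fact_inv // (leq_ltn_trans _ Np).
have EZ : E \is a polyOver Zp.
  apply/polyOverP => i; rewrite coef_poly; case: ltnP; rewrite ?rpred0 // => iN.
  by rewrite rpredM ?Zp_fact_inv ?rpredX ?Zp_int // (ltn_trans iN).
have GH : eq_upto N.+1 (G * H) 1 by apply: expm1_div_truncV.
have G0 : G`_0 = 1 by rewrite coef_poly invr1.
have HZ : H \is a polyOver Zp by apply: (polyOver_series_inv GZ G0 GH); apply: size_poly.
have H0 : H`_0 = 1.
  by have := GH 0 isT; rewrite coefM big_ord1 G0 mul1r coef1.
have FZ : G ^+ n0 * E \is a polyOver Zp by rewrite rpredM ?rpredX.
apply: congr_Zp_mull; first exact: rpred_nat.
(* As GH = 1 in the degrees concerned, n0 of the p factors H cancel against G^n0. *)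
have -> : (H ^+ (p - n0) * E)`_N = (H ^+ p * (G ^+ n0 * E))`_N.
  rewrite -[in RHS](subnK n0p) exprD.
  have -> : H ^+ (p - n0) * H ^+ n0 * (G ^+ n0 * E) = (G * H) ^+ n0 * (H ^+ (p - n0) * E).
    by rewrite exprMn; ring.
  have GHn : eq_upto N.+1 ((G * H) ^+ n0) 1.
    by have := eq_upto_exp n0 GH; rewrite expr1n.
  have HE : eq_upto N.+1 (H ^+ (p - n0) * E) (H ^+ (p - n0) * E) by [].
  by rewrite (eq_upto_mul GHn HE) // mul1r.
rewrite -[X in congr_Zp _ _ X](congr1 (fun A : {poly rat} => A`_N) (mul1r _)).
rewrite !coefM; apply: congr_Zp_sum => i _.
apply: congr_Zp_mulr; first exact: (polyOverP FZ).
by apply: congr_Zp_frobenius => //; have := ltn_ord i; lia.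
Qed.

(** * Quotients of factorials modulo p *)

(** The inverse quotient is (p - 1)(p - 2)...(p - j), congruent to (-1)^j j!. The induction
    multiplies by 1/(p - 1 - j), congruent to -1/(j + 1). *)
Lemma congr_fact_sub j : (j < p)%N ->
  congr_Zp p ((p - 1 - j)`!%:R / (p - 1)`!%:R) ((-1) ^+ j / j`!%:R).
Proof.
elim: j => [|j IHj] jp.
  by rewrite subn0 divff ?fact_rat_neq0 // fact0 divr1; apply: congr_Zp_refl.
have e : (p - 1 - j = (p - 1 - j.+1).+1)%N by lia.
have cinv : congr_Zp p (p - 1 - j)%N%:R^-1 (- j.+1%:R^-1).
  rewrite -invrN; apply: (@congr_Zp_inv (p - 1 - j)%N%:Z (- j.+1%:Z)).
    by apply/eqP; rewrite eqz_mod_dvd; apply/dvdzP; exists 1; lia.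
  by rewrite dvdzE abszN /= ndvdn_small.
have ratioZ : (p - 1 - j)`!%:R / (p - 1)`!%:R \in Zp.
  by rewrite rpredM ?rpred_nat ?Zp_fact_inv //; lia.
have invZ : - j.+1%:R^-1 \in Zp by rewrite rpredN Zp_invn // ndvdn_small.
have := congr_Zp_mul ratioZ invZ (IHj (ltnW jp)) cinv.
have neq0 : (p - 1 - j)%N%:R != 0 :> rat by rewrite e pnatr_eq0.
have -> : (p - 1 - j)`!%:R / (p - 1)`!%:R * (p - 1 - j)%N%:R^-1
    = (p - 1 - j.+1)`!%:R / (p - 1)`!%:R :> rat.
  rewrite e factS -e natrM; field.
  by rewrite neq0 fact_rat_neq0.
have -> : (-1) ^+ j / j`!%:R * - j.+1%:R^-1 = (-1) ^+ j.+1 / j.+1`!%:R :> rat.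
  rewrite factS natrM exprS; field.
  by rewrite fact_rat_neq0 -(natrD _ 1 j) pnatr_eq0.
by [].
Qed.

(** The numerator is p!, and (p + m)!/p! = (p + 1)...(p + m) is congruent to m!. The factor p in the
    numerator cancels the one in (p + m)!. *)
Lemma congr_fact_add m : (m < p)%N ->
  congr_Zp p (p%:R * (p - 1)`!%:R / (p + m)`!%:R) (m`!%:R^-1).
Proof.
have ep : p`! = (p * (p - 1)`!)%N.
  by have := prime_gt0 hp; rewrite subn1; case: (p).
elim: m => [|m IHm] mp.
  rewrite addn0 ep natrM divff ?fact0 ?invr1; first exact: congr_Zp_refl.
  by rewrite -natrM -ep fact_rat_neq0.
have cinv : congr_Zp p (p + m.+1)%N%:R^-1 (m.+1%:R^-1).
  apply: (@congr_Zp_inv (p + m.+1)%N%:Z m.+1%:Z); first by rewrite PoszD modzDl.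
  by rewrite dvdzE /= ndvdn_small.
rewrite addnS !factS !natrM !invfM -addnS [_^-1 * _^-1]mulrC mulrA [_^-1 * _^-1]mulrC.
have pm : m`!%:R^-1 \in Zp by rewrite Zp_fact_inv // ltnW.
apply: (@congr_Zp_trans (m`!%:R^-1 / (p + m.+1)%N%:R)).
  apply: congr_Zp_mulr; last exact/IHm/ltnW.
  by apply: Zp_invn; rewrite dvdn_addr // ndvdn_small.
exact: congr_Zp_mull.
Qed.

(** * Fermat quotients *)

(** The truth value joins Fermat's theorem with the case where p divides a, in which the power
    vanishes modulo p since p - 1 > 0. *)
Lemma congr_fermat (a : int) :
  congr_Zp p (a%:~R ^+ (p - 1)) (1 - (p %| a)%Z%:R).
Proof.
rewrite -rmorphXn /=; case: (boolP (p %| a)%Z) => pa.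
  rewrite subrr; apply: (@congr_Zp_int _ 0); apply/eqP; rewrite eqz_mod_dvd subr0.
  by rewrite dvdz_exp // subn_gt0 prime_gt1.
rewrite subr0; apply: (@congr_Zp_int _ 1); apply/eqP; rewrite eqz_mod_dvd.
exact: fermat_int_coprime.
Qed.

Lemma dvdz_sub_lres (r : int) k : (k < p)%N -> (p %| k%:Z - r)%Z = (k == lres r p).
Proof. by move=> kp; rewrite -eqz_mod_dvd modz_nat modn_small // -lresE. Qed.

(** A single factor a suffices: a q_p(a) = (a^p - a)/p is an integer even when p divides a. *)
Lemma Zp_exp_fermat_quotient (a : int) n : (0 < n)%N ->
  a%:~R ^+ n * fermat_quotient p a \in Zp.
Proof.
case: n => // n _; have /dvdzP[q eq] := fermat_int a.
have -> : a%:~R ^+ n.+1 * fermat_quotient p a = a%:~R ^+ n * q%:~R.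
  rewrite /fermat_quotient exprSr -mulrA; congr (_ * _).
  apply: (mulIf p_rat_neq0); rewrite mulrA mulfVK // mulrBr mulr1.
  by rewrite -exprS subn1 prednK ?prime_gt0 // -rmorphXn -rmorphB eq rmorphM.
by rewrite rpredM ?rpredX ?Zp_int.
Qed.

Lemma exp_fermat_quotient (a : int) n :
  a%:~R ^+ (p - 1 + n) = p%:R * (a%:~R ^+ n * fermat_quotient p a) + a%:~R ^+ n.
Proof. by rewrite /fermat_quotient exprD; field. Qed.

(** * The three cases of the theorem *)

Lemma congr_bernoulli_le (r : int) n0 n1 : (n0 <= n1)%N -> (n1 <= p - 2)%N ->
  congr_Zp p (bernoulli_poly (p - n0) (n1 - n0)).[(- r)%:~R]
    ((n1 ^_ n0)%:R^-1 * pow_diff n0 n1 (- r)%:~R).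
Proof.
move=> n01 n1p; have := prime_gt1 hp => p1.
have := @congr_bernoulli n0 (n1 - n0) (- r); rewrite subnK // => /(_ _ _)/congr_Zp_trans.
apply; [lia|lia|].
rewrite -(ffact_fact n01) natrM; set D := pow_diff _ _ _.
have -> : (n1 - n0)`!%:R * (D / ((n1 ^_ n0)%:R * (n1 - n0)`!%:R)) = (n1 ^_ n0)%:R^-1 * D.
  have nz : (n1 ^_ n0)%:R != 0 :> rat by rewrite pnatr_eq0 -lt0n ffact_gt0.
  by field; rewrite fact_rat_neq0 nz.
exact: congr_Zp_refl.
Qed.

(** Modulo p, (k - r)^(p - 1) is 1 minus the indicator of k = {r}_p. The constant 1 is killed by the
    difference of order n0 > 0, so at most one term remains. *)
Lemma pow_diff_pred (r : int) n0 : (0 < n0 < p)%N ->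
  congr_Zp p (pow_diff n0 (p - 1) (- r)%:~R)
    (- ((-1) ^+ (n0 - lres r p) * 'C(n0, lres r p)%:R)).
Proof.
case/andP=> n0_gt0 n0p.
apply: (@congr_Zp_trans (\sum_(i < n0.+1) 'C(n0, i)%:R * (-1) ^+ (n0 - i)
    * (1 - (i == lres r p :> nat)%:R))).
  apply: congr_Zp_sum => i _; apply: congr_Zp_mull.
    by rewrite rpredM ?rpred_nat // rpredX // rpredN rpred1.
  rewrite -dvdz_sub_lres; last by have := ltn_ord i; lia.
  have -> : i%:R + (- r)%:~R = (i%:Z - r)%:~R :> rat by rewrite [RHS]intrD.
  exact: congr_fermat.
have -> : \sum_(i < n0.+1) 'C(n0, i)%:R * (-1) ^+ (n0 - i)
      * (1 - (i == lres r p :> nat)%:R)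
    = pow_diff n0 0 0 - \sum_(i < n0.+1 | i == lres r p :> nat)
        'C(n0, i)%:R * (-1) ^+ (n0 - i).
  rewrite /pow_diff [X in _ - X]big_mkcond -sumrB; apply: eq_bigr => i _.
  by rewrite expr0 mulr1 mulrBr mulr1; case: eqP => _; rewrite ?mulr1 ?mulr0.
rewrite pow_diff_eq0 // sub0r; apply: congr_Zp_opp.
(* If {r}_p exceeds n0, no index is selected and the binomial coefficient is zero as well. *)
have [lt|ge] := ltnP (lres r p) n0.+1.
  rewrite (big_pred1 (Ordinal lt)) => [|i]; last by [].
  by rewrite mulrC; apply: congr_Zp_refl.
rewrite bin_small // mulr0 big_pred0 => [|i]; first exact: congr_Zp_refl.
by apply/eqP => ei; have := ltn_ord i; rewrite ei ltnNge ge.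
Qed.

Lemma congr_bernoulli_eq0 (r : int) n0 : (0 < n0 < p)%N ->
  congr_Zp p (bernoulli_poly (p - n0) (p - 1 - n0)).[(- r)%:~R]
    ((-1) ^ ((lres r p)%:Z - 1) / n0`!%:R * 'C(n0, lres r p)%:R).
Proof.
move=> n0_int; case/andP: (n0_int) => n0_gt0 n0p.
apply: congr_Zp_trans; first by apply: congr_bernoulli; lia.
rewrite subnK; last by lia.
rewrite mulrCA mulrC; set l := lres r p.
set D := pow_diff _ _ _; set rhs := (X in congr_Zp _ _ X).
(* Signs: (-1)^n0 times -(-1)^(n0 - l) is (-1)^(l - 1), with an integer exponent that is -1 for l =
   0. For l > n0, where [n0 - l] is truncated, both sides vanish. *)
have -> : rhs = (-1) ^+ n0 / n0`!%:R * (- ((-1) ^+ (n0 - l) * 'C(n0, l)%:R)).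
  rewrite /rhs; have [ln|nl] := leqP l n0; last by rewrite bin_small // !(mulr0, oppr0).
  rewrite expfzDr ?oppr_eq0 ?oner_eq0 // -exprnP exprN1 invrN1.
  have -> : (-1) ^+ n0 = (-1) ^+ (n0 - l) * (-1) ^+ l :> rat by rewrite -exprD subnK.
  rewrite -[(-1) ^+ (n0 - l)]signr_odd.
  by case: (odd (n0 - l)); rewrite ?expr0 ?expr1; ring.
apply: congr_Zp_mul (congr_fact_sub n0p) (pow_diff_pred r n0_int).
  by rewrite rpredM ?rpred_nat ?Zp_fact_inv //; lia.
by rewrite rpredN rpredM ?rpred_nat // rpredX // rpredN rpred1.
Qed.

(** The parameters j = n0 - n1 and m = n1 - 1 avoid truncated subtractions. *)
Lemma congr_bernoulli_gt (r : int) j m n0 :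
    (0 < j)%N -> n0 = (j + m.+1)%N -> (n0 < p)%N ->
  congr_Zp p (bernoulli_poly (p - n0) (p - 1 - j)).[(- r)%:~R]
    ((-1) ^+ m.+1 / (j`! * m`!)%:R *
      \sum_(k < n0.+1) 'C(n0, k)%:R * (-1) ^+ k * (k%:Z - r)%:~R ^+ m.+1
         * fermat_quotient p (k%:Z - r)).
Proof.
move=> j_gt0 n0E n0p.
apply: congr_Zp_trans; first by apply: congr_bernoulli; lia.
have -> : (p - 1 - j + n0 = p + m)%N by lia.
set S := (X in congr_Zp _ _ (_ * X)).
have SZ : S \in Zp.
  apply: rpred_sum => k _; rewrite -mulrA rpredM ?Zp_exp_fermat_quotient //.
  by rewrite rpredM ?rpred_nat // rpredX // rpredN rpred1.
(* Since m + 1 < n0, the difference of t^(m + 1) is zero and may be subtracted; each (k - r)^(p + m)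
   then leaves p (k - r)^(m + 1) q_p(k - r). *)
have -> : pow_diff n0 (p + m) (- r)%:~R = p%:R * ((-1) ^+ n0 * S).
  rewrite -[LHS]subr0 -(@pow_diff_eq0 n0 m.+1 (- r)%:~R); last by lia.
  rewrite /pow_diff -sumrB 2!mulr_sumr; apply: eq_bigr => k _.
  have -> : k%:R + (- r)%:~R = (k%:Z - r)%:~R :> rat by rewrite [RHS]intrD.
  have -> : (p + m = p - 1 + m.+1)%N by lia.
  have kn : (k <= n0)%N by rewrite -ltnS.
  have -> : (-1) ^+ n0 = (-1) ^+ (n0 - k) * (-1) ^+ k :> rat by rewrite -exprD subnK.
  rewrite exp_fermat_quotient -[(-1) ^+ k]signr_odd.
  by case: (odd k); rewrite ?expr0 ?expr1; ring.
(* Inserting (p - 1)! separates the two factorial quotients already evaluated modulo p. *)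
have -> : (p - 1 - j)`!%:R * (p%:R * ((-1) ^+ n0 * S) / (p + m)`!%:R)
    = ((p - 1 - j)`!%:R / (p - 1)`!%:R) * (p%:R * (p - 1)`!%:R / (p + m)`!%:R)
      * ((-1) ^+ n0 * S).
  by field; rewrite !fact_rat_neq0.
(* As n0 = j + m + 1, the signs (-1)^j and (-1)^n0 multiply to (-1)^(m + 1). *)
have -> : (-1) ^+ m.+1 / (j`! * m`!)%:R * S
    = ((-1) ^+ j / j`!%:R * m`!%:R^-1) * ((-1) ^+ n0 * S).
  rewrite natrM n0E exprD -[(-1) ^+ j]signr_odd.
  case: (odd j); rewrite ?expr0 ?expr1; field; by rewrite !fact_rat_neq0.
apply: congr_Zp_mulr.
  by rewrite rpredM // rpredX // rpredN rpred1.
apply: congr_Zp_mul; [| |apply: congr_fact_sub|apply: congr_fact_add]; try lia.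
  by rewrite rpredM ?rpred_nat ?Zp_fact_inv //; lia.
by rewrite Zp_fact_inv //; lia.
Qed.

End PIntegral.

Theorem corollary1p2 (p : nat) (hp : prime p) (r : int) (n0 n1 : nat)
    (hn0 : (n0 <= p - 1)%N) (hn1 : (n1 <= p - 2)%N) :
  [/\ (n0 <= n1)%N ->
      congr_Zp p
        (bernoulli_poly (p - n0) (n1 - n0)).[(- r)%:~R]
        (((n1 ^_ n0)%:R)^-1 *
         \sum_(0 <= k < n0.+1)
            'C(n0, k)%:R * (-1) ^+ (n0 - k) * (k%:Z - r)%:~R ^+ n1),
      (n0 > n1)%N /\ n1 = 0%N ->
      congr_Zp p
        (bernoulli_poly (p - n0) (p - n0 + n1 - 1)).[(- r)%:~R]
        ((-1) ^ ((lres r p)%:Z - 1) / n0`!%:R * 'C(n0, lres r p)%:R)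
    & (n0 > n1)%N /\ (n1 > 0)%N ->
      congr_Zp p
        (bernoulli_poly (p - n0) (p - n0 + n1 - 1)).[(- r)%:~R]
        ((-1) ^+ n1 / ((n0 - n1)`! * (n1 - 1)`!)%:R *
         \sum_(0 <= k < n0.+1)
            'C(n0, k)%:R * (-1) ^+ k * (k%:Z - r)%:~R ^+ n1
              * fermat_quotient p (k%:Z - r))].
Proof.
have p1 := prime_gt1 hp.
have subE (k : nat) : k%:R + (- r)%:~R = (k%:Z - r)%:~R :> rat.
  by rewrite [RHS]intrD.
have pow_diffE m : \sum_(0 <= k < n0.+1)
    'C(n0, k)%:R * (-1) ^+ (n0 - k) * (k%:Z - r)%:~R ^+ m = pow_diff n0 m (- r)%:~R.
  by rewrite big_mkord; apply: eq_bigr => k _; rewrite subE.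
split=> [n01|[n10 n1E]|[n10 n1_gt0]].
- by rewrite pow_diffE; apply: congr_bernoulli_le.
- have -> : (p - n0 + n1 - 1 = p - 1 - n0)%N by lia.
  by apply: congr_bernoulli_eq0; lia.
- case: n1 hn1 n10 n1_gt0 => // m hm n0m _; rewrite [(m.+1 - 1)%N]subn1 big_mkord.
  have -> : (p - n0 + m.+1 - 1 = p - 1 - (n0 - m.+1))%N by lia.
  by apply: congr_bernoulli_gt; lia.
Qed.
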